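(* Let $q$ be a prime power, $n\ge2$, $\{\omega,\omega^q\}$ a normal basis of $\mathbf{F}_{q^2}$ over $\mathbf{F}_q$, and let $\iota:\mathbf{F}_q^{2n}\to\mathbf{F}_{q^2}^n$ be the $\mathbf{F}_q$-linear isomorphism $(a_1,\dots,a_n|b_1,\dots,b_n)\mapsto(a_i\omega+b_i\omega^q)_{i=1}^n$. Let $D\subsetneq\mathbf{F}_{q^2}^n$ be an $\mathbf{F}_{q^2}$-linear subspace and $C=\iota^{-1}(D)$, so that $C^{\perp s}=\iota^{-1}(D^{\perp h})$. Assume $C\supsetneq C\cap C^{\perp s}$. Let $\emptyset\ne I\subsetneq K\subseteq\{1,\dots,n\}$ where $K$ is a repair group for $I$, i.e. $\pi_I(C+C^{\perp s})=\pi_I(\sigma_K(C^{\perp s}))$. Let $J$ and $O$ be produced by the modified reduction procedure described in the context. Then $$|K|-|J|\ \ge\ \dim_{\mathbf{F}_{q^2}}\sigma_{K\setminus I}(D^{\perp h}),$$ and $$|J|-|I|\ \le\ \dim_{\mathbf{F}_{q^2}}\pi_K(D)-\dim_{\mathbf{F}_{q^2}}\sigma_I(D^{\perp h}\cap D).$$ Moreover, the set of observables $O$ has size $|O|=\dim_{\mathbf{F}_q}\pi_I(C^{\perp s})$, which is the smallest possible size of a set of observables for correcting erasures in $I$ by the (entanglement-assisted or unassisted) code $Q(C)$ (with any repair group).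
   Context: Notation. $^{\perp h}$ is the dual in $\mathbf{F}_{q^2}^n$ for the Hermitian inner product $\sum_i x_i^q y_i$. For $\vec x=(a_1,\dots,a_m|b_1,\dots,b_m)$, $\vec y=(c_1,\dots,c_m|d_1,\dots,d_m)$ in $\mathbf{F}_q^{2m}$, $\langle \vec x,\vec y\rangle_s=\sum_{i=1}^m (a_id_i-b_ic_i)$; $^{\perp s}$ is the dual for this form; $\operatorname{supp}(\vec x)=\{i:(a_i,b_i)\ne(0,0)\}$. For an index set $K$ and a subspace $S$ of $\mathbf{F}_{q^2}^n$, $\pi_K(S)=\{(a_i)_{i\in K}:\vec a\in S\}$ and $\sigma_K(S)=\{(a_i)_{i\in K}:\vec a\in S,\ a_i=0\text{ for all }i\notin K\}$. For a subspace $S$ of vectors $(\vec a|\vec b)$ over $\mathbf{F}_q$, $\pi_K(S)=\{((a_i)_{i\in K}|(b_i)_{i\in K}):(\vec a|\vec b)\in S\}$ and $\sigma_K(S)=\{((a_i)_{i\in K}|(b_i)_{i\in K}):(\vec a|\vec b)\in S,\ (a_i,b_i)=(0,0)\text{ for all } i\notin K\}$. In the procedure below, shortened spaces are regarded as subspaces of $\mathbf{F}_q^{2n}$ by padding zeros. The code $Q(C)$. Let $2c=\dim_{\mathbf{F}_q} C^{\perp s}-\dim_{\mathbf{F}_q}(C\cap C^{\perp s})$ ($c\ge0$). If $c=0$ put $C'=C$, $\beta=\mathrm{id}$, and $Q(C)$ is the stabilizer code of $C$. If $c>0$, fix an $\mathbf{F}_q$-linear $C'\subseteq\mathbf{F}_q^{2n+2c}$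 (vectors $(a_1,\dots,a_{n+c}|b_1,\dots,b_{n+c})$) with $\dim C'=\dim C+2c$, $\sigma_{\{1,\dots,n\}}(C')=C$, $\pi_{\{1,\dots,n\}}((C')^{\perp s})=C^{\perp s}$, $(C')^{\perp s}\subseteq C'$, and a surjective $\mathbf{F}_p$-linear map $\alpha:C^{\perp s}\to\mathbf{F}_q^{2c}$ ($p$ the characteristic) such that $(C')^{\perp s}$ is the set of vectors $\beta(\vec x)$, $\vec x\in C^{\perp s}$, where $\beta(\vec x)$ has coordinates at indices $1,\dots,n$ given by $\vec x$ and coordinates at indices $n+1,\dots,n+c$ given by $\alpha(\vec x)$ (such $C',\alpha$ exist); $\beta:C^{\perp s}\to(C')^{\perp s}$ is an isomorphism. $Q(C)$ consists of the first $n$ qudits of the stabilizer code of $C'$ on $n+c$ qudits, the last $c$ being held by the decoder without error. Observables. A set of observables is a finite set $T\subseteq(C')^{\perp s}$, of size $|T|$; measuring it for an error $\vec e\in\mathbf{F}_q^{2(n+c)}$ yields the syndromes $\langle\vec e,\vec v\rangle_s$, $\vec v\in T$. It is a set of observables for correcting erasures in $I$ if every $\vec e$ with $\operatorname{supp}(\vec e)\subseteq I$ and $\langle\vec e,\vec v\rangle_s=0$ for all $\vec v\in T$ lies in $(C')^{\perp s}$. The modified reduction procedure. Choose a decomposition $\sigma_K(C^{\perp s})=\sigma_I(C^{\perp s})\oplus\sigma_{K\setminus I}(C^{\perp s})\oplus V$ over $\mathbf{F}_q$, and let $B_I$, $B_V$, $B_W$ be matrices whose rows are $\mathbf{F}_q$-bases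 of $\sigma_I(C^{\perp s})$, $V$ and $W=\sigma_{K\setminus I}(C^{\perp s})$. Let $P\subseteq K\setminus I$ be the set of pivot column indices of a reduced row echelon form of a generator matrix (over $\mathbf{F}_{q^2}$) of $\sigma_{K\setminus I}(D^{\perp h})$, so $|P|=\dim_{\mathbf{F}_{q^2}}\sigma_{K\setminus I}(D^{\perp h})$, and let $C_{\mathrm{sel}}=\{\ell,n+\ell:\ell\in P\}$. Choose a matrix $M$ over $\mathbf{F}_q$ such that $\widetilde B_V=B_V-MB_W$ has zero columns at all indices in $C_{\mathrm{sel}}$. Put $J=I\cup\bigcup_{\vec u\in\operatorname{rows}(\widetilde B_V)}\operatorname{supp}(\vec u)$ and $O=\{\beta(\vec u):\vec u\text{ is a row of }B_I\text{ or of }\widetilde B_V\}$. *)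

(* Defs.v *)
From HB Require Import structures.
From mathcomp Require Import all_boot all_order all_algebra all_field.

Set Implicit Arguments.
Unset Strict Implicit.
Unset Printing Implicit Defensive.

Import GRing.Theory.
Local Open Scope ring_scope.

Section Coordinates.
Variables (R : fieldType) (m : nat).
Implicit Types (A : {set 'I_m}) (S : {vspace 'rV[R]_m}).

Definition mask A (x : 'rV[R]_m) : 'rV[R]_m :=
  \row_j (if j \in A then x 0 j else 0).

Fact mask_is_linear A : linear (mask A).
Proof.
by move=> a x y; apply/rowP => j; rewrite !mxE; case: ifP; rewrite ?mulr0 ?addr0.
Qed.
HB.instance Definition _ A :=
  GRing.isLinear.Build R 'rV[R]_m 'rV[R]_m _ (mask A) (mask_is_linear A).

(* pi_A(S) and sigma_A(S). Both are kept inside the full space R^m by padding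
   with zeros outside A, so that pi_I(sigma_K(S)) needs no reindexing. *)
Definition punctured A S : {vspace 'rV[R]_m} := (linfun (mask A) @: S)%VS.
Definition shortened A S : {vspace 'rV[R]_m} :=
  (S :&: lker (linfun (mask (~: A))))%VS.

Lemma mem_shortened A S x :
  reflect (x \in S /\ forall j, j \notin A -> x 0 j = 0) (x \in shortened A S).
Proof.
rewrite memv_cap memv_ker lfunE /=.
apply: (iffP andP) => -[-> x0]; split=> //.
  by move=> j jA; move/eqP/rowP/(_ j): x0; rewrite !mxE inE jA.
by apply/eqP/rowP => j; rewrite !mxE inE; case: ifP => // /x0.
Qed.

Definition basis_mx k (B : 'M[R]_(k, m)) S :=
  basis_of S [seq row i B | i : 'I_k].

(* Reduced row echelon form without zero rows; the leading entry of row i is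
   in column p i. *)
Definition is_rref k (G : 'M[R]_(k, m)) (p : 'I_k -> 'I_m) : Prop :=
  [/\ forall i i' : 'I_k, (i < i')%N -> (p i < p i')%N,
      forall i (j : 'I_m), (j < p i)%N -> G i j = 0
    & forall i i', G i' (p i) = (i' == i)%:R].

Definition is_pivot_set A S : Prop :=
  exists k (G : 'M[R]_(k, m)) (p : 'I_k -> 'I_m),
    [/\ basis_mx G S, is_rref G p & A = [set p i | i : 'I_k]].

End Coordinates.

Section Hermitian.
Variables (F : finFieldType) (L : fieldExtType F) (n : nat).
Implicit Types (x y : 'rV[L]_n) (D : {vspace 'rV[L]_n}).

Definition herm x y : L := \sum_i x 0 i ^+ #|F| * y 0 i.

Fact herm_is_linear x : linear (herm x : _ -> L^o).
Proof.
move=> a y z; rewrite /herm scaler_sumr -big_split; apply: eq_bigr => i _ /=.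
by rewrite !mxE mulrDr mulrCA.
Qed.
HB.instance Definition _ x :=
  GRing.isLinear.Build L 'rV[L]_n L^o _ (herm x) (herm_is_linear x).

Definition hdual D : {vspace 'rV[L]_n} :=
  (\bigcap_(i < \dim D) lker (linfun (herm (vbasis D)`_i : _ -> L^o)))%VS.

Lemma mem_hdual D y :
  reflect (forall x, x \in D -> herm x y = 0) (y \in hdual D).
Proof.
have exprD (a b : L) : (a + b) ^+ #|F| = a ^+ #|F| + b ^+ #|F|.
  have [p p_pr pcharFp] := finPcharP F; apply: exprDn_pchar.
  have /eq_pnat-> : [pchar L] =i (p : nat_pred).
    by move=> r; rewrite pchar_lalg (pcharf_eq pcharFp).
  by rewrite (card_pprimeChar pcharFp) pnatX pnat_id.
rewrite memvE; apply: (iffP subv_bigcapP) => [D0 x xD | D0 i _].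
  rewrite (coord_vbasis xD).
  apply: (big_ind (fun z => herm z y = 0)) => [|u v u0 v0|i _].
  - rewrite /herm big1 // => j _; rewrite mxE expr0n -[_ == _]negbK -lt0n.
    by rewrite ltnW ?finNzRing_gt1 // mul0r.
  - rewrite -[RHS]addr0 -{1}u0 -v0 -big_split; apply: eq_bigr => j _ /=.
    by rewrite mxE exprD mulrDl.
  rewrite /herm; under eq_bigr => j _ do rewrite !mxE exprMn -mulrA.
  rewrite -mulr_sumr.
  have := D0 i isT; rewrite -memvE memv_ker lfunE /= => /eqP yi0.
  by rewrite -/(herm _ y) yi0 mulr0.
rewrite -memvE memv_ker lfunE /=; apply/eqP/D0/vbasis_mem/mem_nth.
by rewrite size_tuple.
Qed.

End Hermitian.

(* Vectors (a | b) of F^(2n) are row vectors row_mx a b. *)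
Section Symplectic.
Variables (F : fieldType) (n : nat).
Implicit Types (x y : 'rV[F]_(n + n)) (C : {vspace 'rV[F]_(n + n)}).

Definition sform x y : F :=
  \sum_i (lsubmx x 0 i * rsubmx y 0 i - rsubmx x 0 i * lsubmx y 0 i).

Fact sform_is_linear x : linear (sform x : _ -> F^o).
Proof.
move=> a y z; rewrite /sform scaler_sumr -big_split; apply: eq_bigr => i _ /=.
rewrite !mxE scalerBr !mulrDr !(mulrCA _ a) opprD !addrA; congr (_ + _).
by rewrite addrAC.
Qed.
HB.instance Definition _ x :=
  GRing.isLinear.Build F 'rV[F]_(n + n) F^o _ (sform x) (sform_is_linear x).

Definition sdual C : {vspace 'rV[F]_(n + n)} :=
  (\bigcap_(i < \dim C) lker (linfun (sform (vbasis C)`_i : _ -> F^o)))%VS.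

Lemma mem_sdual C y :
  reflect (forall x, x \in C -> sform x y = 0) (y \in sdual C).
Proof.
have sformC u v : sform u v = - sform v u.
  rewrite /sform -sumrN; apply: eq_bigr => i _.
  by rewrite opprB [lsubmx u 0 i * _]mulrC [rsubmx u 0 i * _]mulrC.
rewrite memvE; apply: (iffP subv_bigcapP) => [C0 x xC | C0 i _].
  rewrite sformC (coord_vbasis xC) (linear_sum (sform y)) big1 ?oppr0 // => i _.
  rewrite (linearZ_LR (sform y)) /=.
  have := C0 i isT; rewrite -memvE memv_ker lfunE /= sformC oppr_eq0.
  by move=> /eqP->; rewrite scaler0.
rewrite -memvE memv_ker lfunE /=; apply/eqP/C0/vbasis_mem/mem_nth.
by rewrite size_tuple.
Qed.

Definition supp x : {set 'I_n} :=
  [set i | (lsubmx x 0 i, rsubmx x 0 i) != (0, 0)].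

(* The column indices {l, n + l : l in K}. *)
Definition cols (K : {set 'I_n}) : {set 'I_(n + n)} :=
  [set lshift n l | l in K] :|: [set rshift n l | l in K].

Definition repair_group C (I K : {set 'I_n}) : Prop :=
  punctured (cols I) (C + sdual C)%VS
  = punctured (cols I) (shortened (cols K) (sdual C)).

End Symplectic.

Arguments cols {n} K.

(* iota : F_q^(2n) -> F_(q^2)^n *)
Definition iota_map (F : finFieldType) (L : fieldExtType F) (w : L) n
    (x : 'rV[F]_(n + n)) : 'rV[L]_n :=
  \row_i (lsubmx x 0 i *: w + rsubmx x 0 i *: w ^+ #|F|).

Section EntanglementAssisted.
Variables (F : finFieldType) (n c : nat).
Implicit Types (C : {vspace 'rV[F]_(n + n)}).

(* The vector of F^(2(n+c)) with coordinates x at the indices < n and z at the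
   indices n, ..., n + c - 1. *)
Definition glue (x : 'rV[F]_(n + n)) (z : 'rV[F]_(c + c)) :
    'rV[F]_(n + c + (n + c)) :=
  row_mx (row_mx (lsubmx x) (lsubmx z)) (row_mx (rsubmx x) (rsubmx z)).

Definition restrict (e : 'rV[F]_(n + c + (n + c))) : 'rV[F]_(n + n) :=
  row_mx (lsubmx (lsubmx e)) (lsubmx (rsubmx e)).

Fact restrict_is_linear : linear restrict.
Proof.
move=> a x y; apply/rowP => j; rewrite !mxE.
by case: splitP => i _; rewrite !mxE.
Qed.
HB.instance Definition _ :=
  GRing.isLinear.Build F _ _ _ restrict restrict_is_linear.

Definition first_qudits (I : {set 'I_n}) : {set 'I_(n + c)} :=
  [set lshift c i | i in I].

Definition beta (alpha : 'rV[F]_(n + n) -> 'rV[F]_(c + c)) x := glue x (alpha x).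

(* The data (C', alpha) from which Q(C) is built. Only the values of alpha on
   C^(perp s) matter; the prime field is {k%:R : k in nat}. When c = 0 these
   conditions force C' = C and beta = id, up to the identification of
   F^(2(n+0)) with F^(2n); see ea_extension0. *)
Record ea_extension C (C' : {vspace 'rV[F]_(n + c + (n + c))})
    (alpha : 'rV[F]_(n + n) -> 'rV[F]_(c + c)) : Prop := {
  ea_dim : \dim C' = (\dim C + 2 * c)%N;
  ea_shorten :
    (linfun restrict @: shortened (cols (first_qudits [set: 'I_n])) C')%VS = C;
  ea_puncture : (linfun restrict @: sdual C')%VS = sdual C;
  ea_dual_sub : (sdual C' <= C')%VS;
  ea_alpha_linear : forall (k : nat) x y, x \in sdual C -> y \in sdual C ->
    alpha (k%:R *: x + y) = k%:R *: alpha x + alpha y;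
  ea_alpha_surj : forall z, exists2 x, x \in sdual C & alpha x = z;
  ea_dualE : forall e,
    e \in sdual C' <-> exists2 x, x \in sdual C & e = beta alpha x
}.

(* Observables correcting the erasures in I : every error supported in I with
   zero syndromes lies in the dual of C', i.e. acts trivially on Q(C). *)
Definition erasure_observables (C' : {vspace 'rV[F]_(n + c + (n + c))})
    (I : {set 'I_n})
    (T : {set 'rV[F]_(n + c + (n + c))}) : Prop :=
  (forall v, v \in T -> v \in sdual C') /\
  (forall e, supp e \subset first_qudits I ->
     (forall v, v \in T -> sform e v = 0) -> e \in sdual C').

End EntanglementAssisted.

Lemma ea_extension0 (F : finFieldType) n (C : {vspace 'rV[F]_(n + n)})
    (C' : {vspace 'rV[F]_(n + 0 + (n + 0))}) alpha :
  ea_extension C C' alpha ->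
  (forall e, (e \in C') = (restrict e \in C)) /\
  (forall x, restrict (beta alpha x) = x).
Proof.
case=> _ Csh _ _ _ _ _; split=> [e|x]; last first.
  by rewrite /restrict /beta /glue !row_mxKl !row_mxKr !row_mxKl hsubmxK.
have rK (e1 e2 : 'rV[F]_(n + 0 + (n + 0))) :
    restrict e1 = restrict e2 -> e1 = e2.
  have row0 (u v : 'rV[F]_(n + 0)) : lsubmx u = lsubmx v -> u = v.
    by move=> uv; rewrite -[u]hsubmxK -[v]hsubmxK uv [rsubmx u]thinmx0 [rsubmx v]thinmx0.
  move=> /eq_row_mx[/row0 l12 /row0 r12].
  by rewrite -[e1]hsubmxK -[e2]hsubmxK l12 r12.
apply/idP/idP => [eC'|].
  have <- : linfun (@restrict F n 0) e = restrict e by rewrite lfunE.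
  rewrite -Csh memv_img //; apply/mem_shortened.
  split=> // j; case/negP; rewrite -[j](splitK j) /cols in_setU.
  by case: (split j) => j'; apply/orP; [left|right]; apply/imset_f;
    rewrite -[j'](splitK j'); case: (split j') => [l|[]//]; apply/imset_f.
rewrite -{1}Csh => /memv_imgP[e' /mem_shortened[e'C' _]].
by rewrite lfunE => /rK->.
Qed.

Section Reduction.
Variables (F : finFieldType) (n c kI kV : nat).

Definition reduced_group (I : {set 'I_n}) (BV : 'M[F]_(kV, n + n)) :=
  I :|: \bigcup_(i < kV) supp (row i BV).

Definition reduced_observables (alpha : 'rV[F]_(n + n) -> 'rV[F]_(c + c))
    (BI : 'M[F]_(kI, n + n)) (BV : 'M[F]_(kV, n + n)) :
    {set 'rV[F]_(n + c + (n + c))} :=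
  [set beta alpha (row i BI) | i : 'I_kI]
  :|: [set beta alpha (row i BV) | i : 'I_kV].

End Reduction.

(* Main.v *)
(** [J] is contained in [K] and avoids the pivot set [P], which gives the first
    bound; the second follows from it by the duality
    |A| <= dim sigma_A(D^perp) + dim pi_A(D) for A = K \ I, since
    sigma_I(D) lies in the kernel of pi_K(D) -> pi_{K \ I}(D).

    For the observables, every [F]-valued functional on F^2n is [sform y] for
    some [y], so a subspace is cut out by its symplectic annihilators.  An error
    supported in [I] is [glue x 0], and its syndrome at [beta alpha u] is
    [sform x u].  If all syndromes at [O] vanish, then [x] annihilates
    sigma_K(C^perp), hence, [K] being a repair group, C + C^perp; so [x] lies in
    C and in C^perp, and nondegeneracy on the [c] extra coordinates, onto which
    [alpha] is surjective, forces alpha(x) = 0.  Conversely, if [T] is a set of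
    observables, then every [x] supported in [I] that annihilates the projections
    of [T] to [I] annihilates C^perp, so these projections span a space
    containing pi_I(C^perp). *)
Require Import Defs.
From mathcomp Require Import all_boot all_order all_algebra all_field.
From mathcomp Require Import zify.

Set Implicit Arguments.
Unset Strict Implicit.
Unset Printing Implicit Defensive.

Import GRing.Theory Num.Theory.
Local Open Scope ring_scope.

Local Notation mask := Defs.mask.

(** * Dimensions of punctured and shortened spaces, pivot sets, separating functionals *)

Section Coordinates.
Variables (R : fieldType) (m : nat).
Implicit Types (A B : {set 'I_m}) (S U : {vspace 'rV[R]_m}) (x : 'rV[R]_m).

Lemma mask_id A x : (forall j, j \notin A -> x 0 j = 0) -> mask A x = x.
Proof. by move=> x0; apply/rowP => j; rewrite !mxE; case: ifPn => // /x0. Qed.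

Lemma mem_punctured A S x : x \in S -> mask A x \in punctured A S.
Proof. by move=> xS; rewrite -[mask A x](lfunE (mask A)) memv_img. Qed.

Lemma puncturedP A S y :
  reflect (exists2 x, x \in S & y = mask A x) (y \in punctured A S).
Proof.
apply: (iffP memv_imgP) => -[x xS ->]; exists x => //; first by rewrite lfunE.
by rewrite (lfunE (mask A)).
Qed.

Lemma shortenedS A S U : (S <= U)%VS -> (shortened A S <= shortened A U)%VS.
Proof.
move=> SU; apply/subvP => x /mem_shortened[xS x0].
by apply/mem_shortened; rewrite (subvP SU).
Qed.

Lemma puncturedS A S U : (S <= U)%VS -> (punctured A S <= punctured A U)%VS.
Proof. exact: limgS. Qed.

Lemma dim_punctured_le A S : (\dim (punctured A S) <= #|A|)%N.
Proof.
have sub : (punctured A S <= <<[seq (delta_mx 0 j)%R | j in A]>>)%VS.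
  apply/subvP => _ /puncturedP[x _ ->].
  rewrite [mask A x]row_sum_delta; apply: memv_suml => j _; rewrite mxE.
  case: ifPn => [jA|_]; last by rewrite scale0r mem0v.
  by apply/memvZ/memv_span/image_f.
by rewrite (leq_trans (dimvS sub)) // (leq_trans (dim_span _)) // size_image.
Qed.

(** Rank-nullity on [S]: shortening to [A] is by definition the kernel of masking to the complement
    of [A]. *)
Lemma dim_shortened_punctured A S :
  (\dim (shortened A S) + \dim (punctured (~: A) S) = \dim S)%N.
Proof. exact: limg_ker_dim. Qed.

Lemma shortened_kernel A B S :
  (shortened B S :&: lker (linfun (mask A)))%VS = shortened (B :\: A) S.
Proof.
apply/vspaceP => x; rewrite memv_cap memv_ker lfunE /=.
apply/andP/mem_shortened => [[/mem_shortened[xS x0] /eqP/rowP xA]|[xS x0]].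
  split=> // j; rewrite inE negb_and negbK => /orP[jA|/x0 //].
  by have := xA j; rewrite !mxE jA.
split.
  by apply/mem_shortened; split=> // j jB; apply: x0; rewrite inE (negPf jB) andbF.
by apply/eqP/rowP => j; rewrite !mxE; case: ifP => // jA; rewrite x0 // inE jA.
Qed.

Lemma dim_punctured_shortened A B S :
  (\dim (shortened (B :\: A) S) + \dim (punctured A (shortened B S))
   = \dim (shortened B S))%N.
Proof. by rewrite -shortened_kernel limg_ker_dim. Qed.

Lemma dim_punctured_setD A B S : A \subset B ->
  (\dim (shortened A S) + \dim (punctured (B :\: A) S)
   <= \dim (punctured B S))%N.
Proof.
move=> AB.
rewrite -(limg_ker_dim (linfun (mask (B :\: A))) (punctured B S)) -limg_comp.
(* Rank-nullity has split [punctured B S] along the mask to [B :\: A]. A vector of [shortened A S]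
   is fixed by [mask B] and killed by that mask; conversely, masking by [B] first does not change
   the mask to [B :\: A]. *)
rewrite leq_add //; apply/dimvS/subvP => x.
  case/mem_shortened=> xS x0; rewrite memv_cap memv_ker lfunE /=.
  rewrite -{1}(mask_id (A := B) (x := x)); last first.
    by move=> j jB; apply: x0; apply: contraNN jB => /(subsetP AB).
  rewrite mem_punctured //=; apply/eqP/rowP => j; rewrite !mxE inE.
  by case: ifP => // /andP[/x0].
case/puncturedP=> y yS ->; apply/memv_imgP; exists y => //.
rewrite comp_lfunE !lfunE /=; apply/rowP => j; rewrite !mxE inE.
by case: (j \in A) (j \in B) => [] [].
Qed.

(** A pivot cannot lie outside [B], since its row has entry 1 there but vanishes off [B]. Strictly
    increasing pivots are distinct, so there are as many as basis rows. *)
Lemma is_pivot_set_shortened A B S : is_pivot_set A (shortened B S) ->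
  A \subset B /\ #|A| = \dim (shortened B S).
Proof.
case=> k [G [p [basG [p_mono _ Gp] ->]]]; split.
  apply/subsetP => _ /imsetP[i _ ->]; apply: contraT => piB.
  have /mem_shortened[_ /(_ _ piB)] : row i G \in shortened B S.
    by rewrite (basis_mem basG) ?image_f.
  by rewrite mxE Gp eqxx => /eqP; rewrite oner_eq0.
rewrite card_imset => [|i i' pii']; last first.
  case: (ltngtP i i') => [lt|lt|/val_inj //].
    by have := p_mono _ _ lt; rewrite pii' ltnn.
  by have := p_mono _ _ lt; rewrite pii' ltnn.
have /andP[/eqP<- /eqP->] := basG.
by rewrite size_image.
Qed.

(** A functional has rank at most one, so each kernel costs at most one dimension. *)
Lemma dim_bigcap_lker (J : Type) (s : seq J) (f : J -> 'Hom('rV[R]_m, R^o)) U :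
  (\dim U <= \dim (U :&: \bigcap_(i <- s) lker (f i)) + size s)%N.
Proof.
elim: s U => [|i s IH] U; first by rewrite big_nil capvf addn0.
rewrite big_cons capvA /= addnS -addSn.
have leU : (\dim U <= (\dim (U :&: lker (f i))).+1)%N.
  have le1 : (\dim (f i @: U) <= 1)%N.
    by rewrite (leq_trans (dimvS (subvf _))) ?dimvf.
  by rewrite -(limg_ker_dim (f i) U) -[leqRHS]addn1 leq_add2l.
by rewrite (leq_trans leU) // addSn ltnS.
Qed.

(* The functional is a nonzero coordinate of [z - projv U z]. *)
Lemma separating_functional U x : x \notin U ->
  exists g : 'I_m -> R, \sum_i x 0 i * g i != 0 /\
    forall u, u \in U -> \sum_i u 0 i * g i = 0.
Proof.
move=> xU; have [j xj] : exists j, (x - projv U x) 0 j != 0.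
  apply/existsP; apply: contraNT xU; rewrite negb_exists => /forallP x0.
  suff -> : x = projv U x by apply: memv_proj.
  apply/eqP; rewrite -subr_eq0; apply/eqP/rowP => j.
  by rewrite [RHS]mxE; apply/eqP; have := x0 j; rewrite negbK.
exists (fun i => (delta_mx 0 i - projv U (delta_mx 0 i)) 0 j).
have fE (z : 'rV[R]_m) : \sum_i z 0 i * (delta_mx 0 i - projv U (delta_mx 0 i)) 0 j
          = (z - projv U z) 0 j.
  rewrite [in RHS](row_sum_delta z) linear_sum -sumrB summxE.
  by apply: eq_bigr => i _; rewrite linearZ -scalerBr [RHS]mxE.
by split=> [|u uU]; rewrite fE // projv_id // subrr mxE.
Qed.

Lemma mem_row_basis k (B : 'M[R]_(k, m)) S i : basis_mx B S -> row i B \in S.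
Proof. by move=> basB; rewrite (basis_mem basB) // image_f. Qed.

Lemma basis_mx_dim k (B : 'M[R]_(k, m)) S : basis_mx B S -> \dim S = k.
Proof. by case/andP=> /eqP<- /eqP->; rewrite size_image card_ord. Qed.

End Coordinates.

(** * Lower bounds for dimensions of Hermitian duals *)

Section Hermitian.
Variables (F : finFieldType) (L : fieldExtType F) (n : nat).
Implicit Types (A : {set 'I_n}) (D : {vspace 'rV[L]_n}).

Lemma herm_mask A (x y : 'rV[L]_n) :
  (forall j, j \notin A -> y 0 j = 0) -> herm (mask A x) y = herm x y.
Proof.
move=> y0; apply: eq_bigr => j _; rewrite mxE; case: ifPn => // /y0->.
by rewrite !mulr0.
Qed.

Lemma dim_hdual_ge D : (n <= \dim (hdual D) + \dim D)%N.
Proof.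
have := dim_bigcap_lker (index_enum 'I_(\dim D))
  (fun i => linfun (herm (vbasis D)`_i : _ -> L^o)) fullv.
rewrite capfv dimvf /dim /= mul1n => /leq_trans; apply.
by rewrite leq_add2l /index_enum -enumT size_enum_ord.
Qed.

(** A vector supported in [A] is orthogonal to [D] as soon as it is orthogonal to the puncturing of
    [D] to [A]. *)
Lemma dim_shortened_hdual_ge A D :
  (#|A| <= \dim (shortened A (hdual D)) + \dim (punctured A D))%N.
Proof.
have sub : (shortened A (hdual (punctured A D)) <= shortened A (hdual D))%VS.
  apply/subvP => y /mem_shortened[/mem_hdual yD y0].
  apply/mem_shortened; split=> //; apply/mem_hdual => x xD.
  by rewrite -(herm_mask _ y0) yD // mem_punctured.
(* After adding the size of the complement, the left side is [n], bounded through the dual of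
   [punctured A D]; shortening that dual to [A] loses at most [#|~: A|] dimensions. *)
rewrite -(leq_add2r #|~: A|) cardsC card_ord.
apply: leq_trans (dim_hdual_ge (punctured A D)) _; rewrite addnAC leq_add2r.
rewrite -(dim_shortened_punctured A (hdual _)).
exact: leq_add (dimvS sub) (dim_punctured_le _ _).
Qed.

End Hermitian.

(** * Supports, nondegeneracy and duality for the symplectic form *)

Section Symplectic.
Variables (F : fieldType) (n : nat).
Implicit Types (x y : 'rV[F]_(n + n)) (A K : {set 'I_n})
  (S U : {vspace 'rV[F]_(n + n)}).

Lemma sformC x y : sform x y = - sform y x.
Proof.
rewrite /sform -sumrN; apply: eq_bigr => i _.
by rewrite opprB [lsubmx x 0 i * _]mulrC [rsubmx x 0 i * _]mulrC.
Qed.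

Lemma lshift_cols K l : (lshift n l \in cols K) = (l \in K).
Proof.
rewrite in_setU mem_imset; last exact: lshift_inj.
rewrite orb_idr // => /imsetP[j _ /eqP].
by rewrite eq_lrshift.
Qed.

Lemma rshift_cols K l : (rshift n l \in cols K) = (l \in K).
Proof.
rewrite in_setU orbC mem_imset; last exact: rshift_inj.
rewrite orb_idr // => /imsetP[j _ /eqP].
by rewrite eq_rlshift.
Qed.

Lemma notin_cols K x :
  (forall j, j \notin cols K -> x 0 j = 0) <-> supp x \subset K.
Proof.
split=> [x0|/subsetP suppK j].
  apply/subsetP => l; rewrite inE; apply: contraNT => lK.
  by rewrite !mxE !x0 // (lshift_cols, rshift_cols).
rewrite -[j]splitK; case: (split j) => l /=; rewrite (lshift_cols, rshift_cols);
  by move/(contraNN (suppK l)); rewrite inE negbK !mxE => /eqP[].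
Qed.

Lemma cols_setD A K : cols (K :\: A) = cols K :\: cols A.
Proof.
apply/setP => j; rewrite -[j]splitK in_setD.
by case: (split j) => l /=; rewrite !(lshift_cols, rshift_cols) in_setD.
Qed.

Lemma sform_mask K x y : sform (mask (cols K) x) y = sform x (mask (cols K) y).
Proof.
apply: eq_bigr => i _; rewrite !mxE lshift_cols rshift_cols.
by case: ifP; rewrite ?mul0r ?mulr0.
Qed.

Lemma sform_span x (s : seq 'rV[F]_(n + n)) :
  (forall u, u \in s -> sform x u = 0) ->
  forall u, u \in <<s>>%VS -> sform x u = 0.
Proof.
move=> xs u; suff /subvP/(_ u) : (<<s>> <= lker (linfun (sform x : _ -> F^o)))%VS.
  by move=> sub /sub; rewrite memv_ker lfunE => /eqP.
by apply/span_subvP => v /xs xv; rewrite memv_ker lfunE /= xv.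
Qed.

Lemma sform_separates U x : x \notin U ->
  exists2 y, sform y x != 0 & forall u, u \in U -> sform y u = 0.
Proof.
move=> /separating_functional[g [gx gU]].
(* The halves of [g] are swapped and one is negated, so that [sform y] becomes the functional with
   coefficients [g]. *)
pose y : 'rV[F]_(n + n) :=
  row_mx (\row_i g (rshift n i)) (- \row_i g (lshift n i)).
have yE z : sform y z = \sum_i z 0 i * g i.
  rewrite big_split_ord /= -big_split; apply: eq_bigr => i _.
  by rewrite row_mxKl row_mxKr !mxE mulNr opprK addrC mulrC [g (rshift n i) * _]mulrC.
by exists y => [|u uU]; rewrite yE // gU.
Qed.

Lemma sform_nondegenerate x : (forall y, sform x y = 0) -> x = 0.
Proof.
move=> x0; apply/eqP; rewrite -memv0; apply: contraT.
by case/sform_separates => y; rewrite sformC x0 oppr0 eqxx.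
Qed.

Lemma sdualK U : sdual (sdual U) = U.
Proof.
apply/vspaceP => x; apply/mem_sdual/idP => [xU|xU y /mem_sdual yU]; last first.
  by rewrite sformC yU ?oppr0.
apply: contraT => /sform_separates[y /eqP yx yU]; case: yx; apply: xU.
by apply/mem_sdual => u uU; rewrite sformC yU ?oppr0.
Qed.

Lemma dim_punctured_le_annihilators A S (s : seq 'rV[F]_(n + n)) :
  (forall x, supp x \subset A -> (forall v, v \in s -> sform x v = 0) ->
     forall u, u \in S -> sform x u = 0) ->
  (\dim (punctured (cols A) S) <= size s)%N.
Proof.
move=> annS; pose s' := [seq mask (cols A) v | v <- s].
rewrite -(size_map (mask (cols A)) s) -/s'.
apply: leq_trans (dimvS _) (dim_span s').
(* If the masked [u] were outside the span of [s'], some [y] would separate them; the masked [y] is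
   then supported in [A] and kills [s] but not [u]. *)
apply/subvP => _ /puncturedP[u uS ->]; apply: contraT => /sform_separates[y].
rewrite -sform_mask => /eqP yu ys; case: yu; apply: annS => // [|v vs].
  by apply/notin_cols => j jA; rewrite mxE (negPf jA).
by rewrite sform_mask ys // memv_span ?map_f.
Qed.

End Symplectic.

(** * Errors and observables on the extended code *)

Section EntanglementAssisted.
Variables (F : finFieldType) (n c : nat).
Implicit Types (x y : 'rV[F]_(n + n)) (z t : 'rV[F]_(c + c))
  (e : 'rV[F]_(n + c + (n + c))) (T : {set 'rV[F]_(n + c + (n + c))}).

Lemma restrict_glue x z : restrict (glue x z) = x.
Proof. by rewrite /restrict row_mxKl row_mxKr !row_mxKl hsubmxK. Qed.

Lemma sform_glue x y z t : sform (glue x z) (glue y t) = sform x y + sform z t.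
Proof.
rewrite /sform big_split_ord; congr (_ + _); apply: eq_bigr => i _ /=;
  by rewrite !row_mxKl !row_mxKr ?row_mxEl ?row_mxEr.
Qed.

Lemma sform_glue0 x y t : sform (glue x 0) (glue y t) = sform x y.
Proof. by rewrite sform_glue [sform 0 _]sformC (raddf0 (sform t)) oppr0 addr0. Qed.

Lemma glueB x y z t : glue x z - glue y t = glue (x - y) (z - t).
Proof. by rewrite /glue !linearB /= -!add_row_mx !opp_row_mx. Qed.

Lemma lshift_first_qudits (I : {set 'I_n}) i :
  (lshift c i \in first_qudits c I) = (i \in I).
Proof. by rewrite mem_imset //; apply: lshift_inj. Qed.

Lemma rshift_first_qudits (I : {set 'I_n}) i :
  (rshift n i \in first_qudits c I) = false.
Proof. by apply/imsetP => -[j _ /eqP]; rewrite eq_rlshift. Qed.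

Lemma supp_first_qudits (I : {set 'I_n}) e : supp e \subset first_qudits c I ->
  e = glue (restrict e) 0 /\ supp (restrict e) \subset I.
Proof.
move=> /subsetP eI; split.
  have e0 i : lsubmx e 0 (rshift n i) = 0 /\ rsubmx e 0 (rshift n i) = 0.
    have := eI (rshift n i); rewrite rshift_first_qudits inE.
    by case: eqP => [[-> ->]|_ /(_ isT)].
  rewrite /glue row_mxKl row_mxKr -[LHS]hsubmxK; congr row_mx.
    rewrite -[LHS]hsubmxK; congr row_mx; apply/rowP => i.
    by rewrite !mxE; have [] := e0 i; rewrite mxE.
  rewrite -[LHS]hsubmxK; congr row_mx; apply/rowP => i.
  by rewrite !mxE; have [] := e0 i; rewrite [in rsubmx _ _ _]mxE.
apply/subsetP => i; rewrite inE row_mxKl row_mxKr => ei.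
by rewrite -(lshift_first_qudits I) eI // inE; rewrite !mxE in ei *.
Qed.

Lemma supp_glue0 (I : {set 'I_n}) x : supp x \subset I ->
  supp (glue x (0 : 'rV[F]_(c + c))) \subset first_qudits c I.
Proof.
move=> /subsetP xI; apply/subsetP => i; rewrite -[i]splitK inE row_mxKl row_mxKr.
case: (split i) => l /=.
  by rewrite !row_mxEl lshift_first_qudits => xl; rewrite xI ?inE.
by rewrite !row_mxEr !mxE eqxx.
Qed.

Lemma beta_inj (alpha : 'rV[F]_(n + n) -> 'rV[F]_(c + c)) : injective (beta alpha).
Proof. by move=> x y /(congr1 (@restrict F n c)); rewrite !restrict_glue. Qed.

Variables (C : {vspace 'rV[F]_(n + n)}) (C' : {vspace 'rV[F]_(n + c + (n + c))})
  (alpha : 'rV[F]_(n + n) -> 'rV[F]_(c + c)).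
Hypothesis extC : ea_extension C C' alpha.

Lemma beta_sdual x : x \in sdual C -> beta alpha x \in sdual C'.
Proof. by move=> xS; apply/(ea_dualE extC); exists x. Qed.

Lemma glue0_sdual x : x \in C -> x \in sdual C -> glue x 0 \in sdual C'.
Proof.
move=> xC xS; have xC' : glue x 0 \in C'.
  move: xC; rewrite -{1}(ea_shorten extC) => /memv_imgP[e /mem_shortened[eC']].
  move/notin_cols/supp_first_qudits => -[e0 _].
  by rewrite lfunE /= => ->; rewrite -e0.
(* The difference of the two elements of [C'] over [x] is [glue 0 (alpha x)]. Pairing it with
   [beta alpha u], for [u] in [sdual C], leaves only [sform (alpha x) (alpha u)], where [alpha u] is
   arbitrary. *)
have bxC' : beta alpha x \in C' by rewrite (subvP (ea_dual_sub extC)) ?beta_sdual.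
have /rpredB/(_ xC') := bxC'; rewrite glueB subrr subr0 => axC'.
suff ax0 : alpha x = 0 by have := beta_sdual xS; rewrite /beta ax0.
apply: sform_nondegenerate => t; have [u uS <-] := ea_alpha_surj extC t.
have /mem_sdual/(_ _ axC') := beta_sdual uS.
by rewrite sform_glue [sform 0 u]sformC (raddf0 (sform u)) oppr0 add0r.
Qed.

Lemma erasure_observables_size (I : {set 'I_n}) T :
  erasure_observables C' I T -> (\dim (punctured (cols I) (sdual C)) <= #|T|)%N.
Proof.
case=> TS' corrT; rewrite cardE -(size_map (@restrict F n c)).
apply: dim_punctured_le_annihilators => x xI xT u uS.
have xS' : glue x 0 \in sdual C'.
  apply: corrT => [|v vT]; first exact: supp_glue0.
  have /(ea_dualE extC)[y _ vE] := TS' v vT.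
  rewrite vE sform_glue0 xT //; apply/mapP; exists v; rewrite ?mem_enum //.
  by rewrite vE restrict_glue.
(* The undetected error lies in [sdual C'], hence in [C'], and is therefore orthogonal to every
   [beta alpha u]. *)
have /mem_sdual/(_ (glue x 0)) := beta_sdual uS; rewrite sform_glue0; apply.
exact: (subvP (ea_dual_sub extC)).
Qed.

Lemma repair_group_erasure_observables (I K : {set 'I_n}) T :
  repair_group C I K -> (forall v, v \in T -> v \in sdual C') ->
  (forall x, supp x \subset I ->
     (forall v, v \in T -> sform (glue x 0) v = 0) ->
     forall u, u \in shortened (cols K) (sdual C) -> sform x u = 0) ->
  erasure_observables C' I T.
Proof.
move=> repK TS' annT; split=> // e /supp_first_qudits[-> ]; move: (restrict e) => x.
rewrite restrict_glue => xI xT.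
have xE : mask (cols I) x = x by exact: (mask_id ((notin_cols I x).2 xI)).
(* As [x] is supported in [I], only the projection of [u] to [I] matters, and the repair group
   supplies a [v] in the shortened dual with the same projection. *)
have xCS u : u \in (C + sdual C)%VS -> sform x u = 0.
  move=> /(mem_punctured (cols I)); rewrite repK => /puncturedP[v vK uv].
  by rewrite -xE sform_mask uv -sform_mask xE annT.
apply: glue0_sdual; last first.
  by apply/mem_sdual => u uC; rewrite sformC xCS ?oppr0 // (subvP (addvSl _ _)).
rewrite -[C]sdualK; apply/mem_sdual => u uS.
by rewrite sformC xCS ?oppr0 // (subvP (addvSr _ _)).
Qed.

End EntanglementAssisted.

(** * The reduced basis, its observables and the reduced group *)

Section Reduction.
Variables (F : finFieldType) (n c kI kV kW : nat).
Variables (C : {vspace 'rV[F]_(n + n)}) (C' : {vspace 'rV[F]_(n + c + (n + c))})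
  (alpha : 'rV[F]_(n + n) -> 'rV[F]_(c + c)).
Variables (I K : {set 'I_n}) (V : {vspace 'rV[F]_(n + n)}).
Variables (BI : 'M[F]_(kI, n + n)) (BV : 'M[F]_(kV, n + n))
  (BW : 'M[F]_(kW, n + n)) (M : 'M[F]_(kV, kW)).
Hypothesis extC : ea_extension C C' alpha.
Hypothesis repK : repair_group C I K.
Hypothesis decK :
  (shortened (cols I) (sdual C) + shortened (cols (K :\: I)) (sdual C) + V)%VS
    = shortened (cols K) (sdual C).
Hypothesis dirK :
  directv (shortened (cols I) (sdual C) + shortened (cols (K :\: I)) (sdual C) + V).
Hypotheses (basI : basis_mx BI (shortened (cols I) (sdual C)))
  (basV : basis_mx BV V)
  (basW : basis_mx BW (shortened (cols (K :\: I)) (sdual C))).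

Let BV' := BV - M *m BW.
Let rowsI := [seq row i BI | i : 'I_kI].
Let rowsV := [seq row i BV' | i : 'I_kV].
Let rowsW := [seq row i BW | i : 'I_kW].

Lemma mem_mulmx_row i (U : {vspace 'rV[F]_(n + n)}) :
  (forall k, row k BW \in U) -> row i (M *m BW) \in U.
Proof.
move=> BWU; rewrite row_mul mulmx_sum_row.
by apply: memv_suml => k _; apply/memvZ.
Qed.

Lemma row_reduced_mem i : row i BV' \in shortened (cols K) (sdual C).
Proof.
rewrite /BV' linearB /= -decK rpredB //.
  by rewrite (subvP (addvSr _ _)) // (mem_row_basis _ basV).
apply/(subvP (addvSl _ _))/(subvP (addvSr _ _))/mem_mulmx_row => k.
exact: (mem_row_basis _ basW).
Qed.

Lemma dim_shortened_decomposition :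
  \dim (shortened (cols K) (sdual C)) = (kI + kW + kV)%N.
Proof.
rewrite -decK; move: dirK; rewrite directvE /= => /eqP->.
by rewrite (basis_mx_dim basI) (basis_mx_dim basV) (basis_mx_dim basW).
Qed.

(** Subtracting combinations of rows of [BW] from [BV] is undone using [rowsW], so the span is
    unchanged; the number of vectors equals the dimension, which gives freeness. *)
Lemma reduced_basis :
  basis_of (shortened (cols K) (sdual C)) ((rowsI ++ rowsV) ++ rowsW).
Proof.
rewrite basisEdim dim_shortened_decomposition; apply/andP; split; last first.
  by rewrite !size_cat !size_image !card_ord addnAC.
have rW k : row k BW \in <<(rowsI ++ rowsV) ++ rowsW>>%VS.
  by rewrite memv_span // mem_cat [_ \in rowsW]image_f ?orbT.
rewrite -decK !subv_add -(span_basis basI) -(span_basis basW) -(span_basis basV).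
apply/andP; split; first (apply/andP; split).
- by rewrite span_cat span_cat -addvA addvSl.
- by rewrite span_cat addvSr.
apply/span_subvP => _ /imageP[i _ ->].
have -> : row i BV = row i BV' + row i (M *m BW) by rewrite linearB subrK.
rewrite memvD ?mem_mulmx_row //.
by rewrite memv_span // !mem_cat [_ \in rowsV]image_f ?orbT.
Qed.

Lemma mem_reduced_observables v :
  reflect (exists2 u, u \in rowsI ++ rowsV & v = beta alpha u)
    (v \in reduced_observables alpha BI BV').
Proof.
rewrite in_setU; apply: (iffP orP) => [|[u]].
  by case=> /imsetP[i _ ->];
    [exists (row i BI) | exists (row i BV')]; rewrite // mem_cat;
    [rewrite [_ \in rowsI]image_f | rewrite [_ \in rowsV]image_f ?orbT].
by rewrite mem_cat => /orP[]/imageP[i _ ->] ->; [left|right]; apply: imset_f.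
Qed.

Lemma card_reduced_observables :
  #|reduced_observables alpha BI BV'| = \dim (punctured (cols I) (sdual C)).
Proof.
have uniqIV : uniq (rowsI ++ rowsV).
  have /andP[_ /free_uniq] := reduced_basis.
  by rewrite cat_uniq => /andP[].
rewrite (eq_card (B := [in map (beta alpha) (rowsI ++ rowsV)])); last first.
  by move=> v; apply/mem_reduced_observables/mapP.
move: uniqIV; rewrite -(map_inj_uniq (@beta_inj F n c alpha)) => /card_uniqP->.
rewrite size_map size_cat !size_image !card_ord.
(* The projection of [sdual C] lies between those of [shortened (cols K) (sdual C)] and
   [C + sdual C], which agree for a repair group. *)
have -> : punctured (cols I) (sdual C)
        = punctured (cols I) (shortened (cols K) (sdual C)).
  apply/eqP; rewrite eqEsubv -{1}repK !puncturedS ?addvSr //.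
  exact: capvSl.
(* Projecting to [I] has kernel the shortening to [K :\: I], of dimension [kW]; the image thus has
   dimension [kI + kV]. *)
have := dim_punctured_shortened (cols I) (cols K) (sdual C).
rewrite -cols_setD dim_shortened_decomposition (basis_mx_dim basW) addnAC addnC.
by move/addIn.
Qed.

Lemma reduced_observables_erasure :
  erasure_observables C' I (reduced_observables alpha BI BV').
Proof.
apply: (repair_group_erasure_observables extC repK).
  move=> _ /mem_reduced_observables[u uIV ->]; apply: (beta_sdual extC).
  suff /mem_shortened[] : u \in shortened (cols K) (sdual C) by [].
  by rewrite (basis_mem reduced_basis) // mem_cat uIV.
move=> x xI xO; rewrite -(span_basis reduced_basis); apply: sform_span => u.
rewrite mem_cat => /orP[uIV|/imageP[i _ ->]].
  rewrite -(sform_glue0 x u (alpha u)) xO //.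
  by apply/mem_reduced_observables; exists u.
(* Rows of [BW] vanish on [I], so their syndromes for errors supported in [I] are zero without being
   measured. *)
have /mem_shortened[_ W0] := mem_row_basis i basW.
have <- : mask (cols I) x = x by exact: (mask_id ((notin_cols I x).2 xI)).
rewrite sform_mask.
suff -> : mask (cols I) (row i BW) = 0 by exact: (raddf0 (sform x)).
apply/rowP => j; rewrite [LHS]mxE [RHS]mxE; case: ifP => // jI.
by apply: W0; rewrite cols_setD in_setD jI.
Qed.

Lemma reduced_group_sub : I \subset K -> reduced_group I BV' \subset K.
Proof.
move=> IK; rewrite subUset IK; apply/bigcupsP => i _; apply/notin_cols.
by have /mem_shortened[] := row_reduced_mem i.
Qed.

Lemma reduced_group_disjoint (P : {set 'I_n}) : P \subset ~: I ->
  (forall i j, j \in cols P -> BV' i j = 0) -> reduced_group I BV' \subset ~: P.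
Proof.
move=> PI BP; rewrite subUset subsetC PI; apply/bigcupsP => i _.
apply/subsetP => l; rewrite !inE; apply: contraNN => lP.
have BPi j : j \in cols P -> row i BV' 0 j = 0 by rewrite mxE; apply: BP.
by rewrite [lsubmx _ _ _]mxE [rsubmx _ _ _]mxE !BPi // (lshift_cols, rshift_cols).
Qed.

End Reduction.

Theorem proposition4p4 (F : finFieldType) (L : fieldExtType F) (n c : nat)
    (w : L) (D : {vspace 'rV[L]_n}) (C : {vspace 'rV[F]_(n + n)})
    (C' : {vspace 'rV[F]_(n + c + (n + c))})
    (alpha : 'rV[F]_(n + n) -> 'rV[F]_(c + c))
    (I K P : {set 'I_n}) (V : {vspace 'rV[F]_(n + n)}) (kI kV kW : nat)
    (BI : 'M[F]_(kI, n + n)) (BV : 'M[F]_(kV, n + n)) (BW : 'M[F]_(kW, n + n))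
    (M : 'M[F]_(kV, kW)) :
  (2 <= n)%N ->
  \dim {:L} = 2%N ->
  basis_of {:L} [:: w; w ^+ #|F|] ->
  D <> fullv ->
  (forall x, (x \in C) = (iota_map w x \in D)) ->
  (C :&: sdual C)%VS <> C ->
  (2 * c = \dim (sdual C) - \dim (C :&: sdual C))%N ->
  ea_extension C C' alpha ->
  I != set0 ->
  I \proper K ->
  repair_group C I K ->
  (shortened (cols I) (sdual C) + shortened (cols (K :\: I)) (sdual C) + V)%VS
    = shortened (cols K) (sdual C) ->
  directv (shortened (cols I) (sdual C) + shortened (cols (K :\: I)) (sdual C) + V) ->
  basis_mx BI (shortened (cols I) (sdual C)) ->
  basis_mx BV V ->
  basis_mx BW (shortened (cols (K :\: I)) (sdual C)) ->
  is_pivot_set P (shortened (K :\: I) (hdual D)) ->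
  (forall i j, j \in cols P -> (BV - M *m BW) i j = 0) ->
  let J := reduced_group I (BV - M *m BW) in
  let Obs := reduced_observables alpha BI (BV - M *m BW) in
  [/\ #|K|%:Z - #|J|%:Z >= (\dim (shortened (K :\: I) (hdual D)))%:Z,
      #|J|%:Z - #|I|%:Z <= (\dim (punctured K D))%:Z
                           - (\dim (shortened I (hdual D :&: D)))%:Z,
      #|Obs| = \dim (punctured (cols I) (sdual C)),
      erasure_observables C' I Obs
    & forall T : {set 'rV[F]_(n + c + (n + c))}, erasure_observables C' I T ->
        (\dim (punctured (cols I) (sdual C)) <= #|T|)%N].
Proof.
move=> _ _ _ _ _ _ _ extC _ /properP[IK _] repK decK dirK basI basV basW.
move=> /is_pivot_set_shortened[PKI cardP] BP J Obs.
have PI : P \subset ~: I by rewrite (subset_trans PKI) // setDE subsetIr.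
have cardJ : (#|J| + \dim (shortened (K :\: I) (hdual D)) <= #|K|)%N.
  (* The reduced rows stay in the shortening to [K] and have both columns of every index in [P]
     cleared; [P] also avoids [I]. *)
  have JKP : J \subset K :\: P.
    rewrite setDE subsetI (reduced_group_sub M decK basV basW IK).
    exact: reduced_group_disjoint.
  have PK : P \subset K by rewrite (subset_trans PKI) ?subsetDl.
  by rewrite -cardP -(cardsID P K) (setIidPr PK) addnC leq_add2l subset_leq_card.
split.
- by rewrite lerBrDr addrC -PoszD lez_nat.
(* With [cardJ], the first inequality bounds [#|J| - #|I|] by the dimension of
   [punctured (K :\: I) D]; the second trades it for [punctured K D] minus [shortened I D], and the
   third replaces [D] there by its smaller intersection with the dual. *)
- have := dim_shortened_hdual_ge (K :\: I) D.
  have := dim_punctured_setD D IK.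
  have := dimvS (shortenedS I (capvSr (hdual D) D)).
  rewrite cardsDS //; have := subset_leq_card IK; lia.
- exact: (card_reduced_observables alpha M repK decK dirK basI basV basW).
- exact: (reduced_observables_erasure M extC repK decK dirK basI basV basW).
move=> T; exact: (erasure_observables_size extC).
Qed.
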